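(* Let $H$ be a closed, unbounded, densely defined linear operator in $\mathcal{H}$. Then (1) there exist uncountably many subspaces $\mathfrak{M}$ of $\mathcal{H}$ such that $\mathfrak{M}\cap\operatorname{dom}H=\mathfrak{M}^\perp\cap\operatorname{dom}H=\{0\}$; (2) there exist uncountably many fundamental symmetries $J$ in $\mathcal{H}$ such that $J\operatorname{dom}H\cap\operatorname{dom}H=\{0\}$.
   Context: $\mathcal{H}$ is a complex, infinite-dimensional, separable Hilbert space. A subspace means a closed linear subspace; $\mathfrak{M}^\perp=\mathcal{H}\ominus\mathfrak{M}$. A fundamental symmetry is a bounded operator $J$ on $\mathcal{H}$ with $J=J^*=J^{-1}$. *)

(* Defs.v *)
From Stdlib Require Import Reals.
Open Scope R_scope.

Record C : Type := mkC { Re : R ; Im : R }.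
Definition C0 : C := mkC 0 0.
Definition C1 : C := mkC 1 0.
Definition Cadd (a b : C) : C := mkC (Re a + Re b) (Im a + Im b).
Definition Copp (a : C) : C := mkC (- Re a) (- Im a).
Definition Cmul (a b : C) : C :=
  mkC (Re a * Re b - Im a * Im b) (Re a * Im b + Im a * Re b).
Definition Cconj (a : C) : C := mkC (Re a) (- Im a).

Record HilbertSpace (V : Type) : Type := {
  vzero : V ;
  vadd : V -> V -> V ;
  vopp : V -> V ;
  vscal : C -> V -> V ;
  inner : V -> V -> C ;
  vadd_assoc : forall x y z, vadd x (vadd y z) = vadd (vadd x y) z ;
  vadd_comm : forall x y, vadd x y = vadd y x ;
  vadd_zero : forall x, vadd x vzero = x ;
  vadd_opp : forall x, vadd x (vopp x) = vzero ;
  vscal_one : forall x, vscal C1 x = x ;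
  vscal_mul : forall a b x, vscal a (vscal b x) = vscal (Cmul a b) x ;
  vscal_addv : forall a x y, vscal a (vadd x y) = vadd (vscal a x) (vscal a y) ;
  vscal_addc : forall a b x, vscal (Cadd a b) x = vadd (vscal a x) (vscal b x) ;
  inner_add_l : forall x y z, inner (vadd x y) z = Cadd (inner x z) (inner y z) ;
  inner_scal_l : forall a x y, inner (vscal a x) y = Cmul a (inner x y) ;
  inner_conj_sym : forall x y, inner y x = Cconj (inner x y) ;
  inner_pos : forall x, 0 <= Re (inner x x) ;
  inner_def : forall x, inner x x = C0 -> x = vzero ;
  complete : forall u : nat -> V,
    (forall eps, 0 < eps -> exists N, forall m n, (N <= m)%nat -> (N <= n)%nat ->
        sqrt (Re (inner (vadd (u m) (vopp (u n))) (vadd (u m) (vopp (u n))))) < eps) ->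
    exists l, forall eps, 0 < eps -> exists N, forall n, (N <= n)%nat ->
        sqrt (Re (inner (vadd (u n) (vopp l)) (vadd (u n) (vopp l)))) < eps ;
  separable : exists d : nat -> V, forall x eps, 0 < eps -> exists n,
        sqrt (Re (inner (vadd x (vopp (d n))) (vadd x (vopp (d n))))) < eps ;
  infinite_dim : forall (n : nat) (e : nat -> V), exists x, forall c : nat -> C,
        x <> (fix s (k : nat) : V :=
                match k with O => vzero | S k' => vadd (s k') (vscal (c k') (e k')) end) n
}.

Arguments vzero {V} _.
Arguments vadd {V} _ _ _.
Arguments vopp {V} _ _.
Arguments vscal {V} _ _ _.
Arguments inner {V} _ _ _.

Section Notions.
Context {V : Type} (HS : HilbertSpace V).

Definition vsub (x y : V) : V := vadd HS x (vopp HS y).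
Definition norm (x : V) : R := sqrt (Re (inner HS x x)).

Definition converges_to (u : nat -> V) (l : V) : Prop :=
  forall eps, 0 < eps -> exists N, forall n, (N <= n)%nat -> norm (vsub (u n) l) < eps.

Definition linear_manifold (M : V -> Prop) : Prop :=
  M (vzero HS) /\ (forall x y, M x -> M y -> M (vadd HS x y)) /\
  (forall a x, M x -> M (vscal HS a x)).

Definition closed_set (M : V -> Prop) : Prop :=
  forall u l, (forall n, M (u n)) -> converges_to u l -> M l.
Definition subspace (M : V -> Prop) : Prop := linear_manifold M /\ closed_set M.

Definition ortho (M : V -> Prop) : V -> Prop :=
  fun x => forall y, M y -> inner HS x y = C0.

Definition dense (D : V -> Prop) : Prop :=
  forall x eps, 0 < eps -> exists z, D z /\ norm (vsub x z) < eps.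

(* A linear operator in the Hilbert space: a domain [dom] (linear manifold)
   and an action [T] (values of T outside dom are irrelevant). *)
Definition linear_operator (dom : V -> Prop) (T : V -> V) : Prop :=
  linear_manifold dom /\
  (forall x y, dom x -> dom y -> T (vadd HS x y) = vadd HS (T x) (T y)) /\
  (forall a x, dom x -> T (vscal HS a x) = vscal HS a (T x)).

Definition closed_operator (dom : V -> Prop) (T : V -> V) : Prop :=
  forall u x y, (forall n, dom (u n)) -> converges_to u x ->
    converges_to (fun n => T (u n)) y -> dom x /\ T x = y.

Definition densely_defined (dom : V -> Prop) : Prop := dense dom.

Definition unbounded_operator (dom : V -> Prop) (T : V -> V) : Prop :=
  ~ exists c, forall x, dom x -> norm (T x) <= c * norm x.

Definition bounded_linear (J : V -> V) : Prop :=
  (forall x y, J (vadd HS x y) = vadd HS (J x) (J y)) /\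
  (forall a x, J (vscal HS a x) = vscal HS a (J x)) /\
  (exists c, forall x, norm (J x) <= c * norm x).

Definition fundamental_symmetry (J : V -> V) : Prop :=
  bounded_linear J /\
  (forall x y, inner HS (J x) y = inner HS x (J y)) /\
  (forall x, J (J x) = x).

Definition uncountably_many_sets (P : (V -> Prop) -> Prop) : Prop :=
  ~ exists f : nat -> (V -> Prop),
      forall M, P M -> exists n, forall x, f n x <-> M x.

Definition uncountably_many_ops (P : (V -> V) -> Prop) : Prop :=
  ~ exists f : nat -> (V -> V),
      forall J, P J -> exists n, forall x, f n x = J x.

End Notions.

(* Main.v *)
(* Since [T] is closed and unbounded, a greedy (open mapping) argument shows that, orthogonally to
   any finite set and for any [eps > 0], there is a unit vector [f] with
   [|<x, f>| <= eps * (graph norm of x)] on [dom]. Interleaving such vectors with Gram-Schmidt steps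
   yields an orthonormal basis [g] in which every [x] in [dom] has coefficients [O(4^-n)] at
   infinitely many prescribed indices [n] of either parity.

   Tilt the basis: [h n = g n + s n * sum_i K n i * g i] ([tilted]), where [s n = 1] for even [n] and
   [-1] for odd [n], and [K] ([coupling]) is symmetric and couples only indices of opposite parity, so that the even [h n] are
   orthogonal to the odd ones. Each prescribed [n] is coupled, with weight [delta n] about [2^-n], to
   an earlier index [target n]. If [x] in [dom] is orthogonal to all [h n] of one parity, its
   coefficient at [target n] is [O(4^-n / 2^-n)]; each index of the other parity is a target
   infinitely often, so these coefficients vanish, and then [x _|_ h n] gives the remaining ones.
   Hence [M], the orthogonal complement of the odd [h n], and its complement both meet [dom] trivially.
   Halving the [delta n] at will gives a Cantor family of distinct [M].

   If [x] and [J x] lie in [dom] then so do [x + J x] and [x - J x], so the reflection [J] in such an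
   [M] satisfies (2), and [M] is recovered as the fixed space of [J]. *)
Require Import Defs.
From Stdlib Require Import Reals.
From Stdlib Require Import Lra Lia List Classical IndefiniteDescription Cantor.

(** * Real inner product, geometric limits and orthogonal projection *)

Section RealInnerProduct.
Context {V : Type} (HS : HilbertSpace V).

(** Computations use the real part of the inner product, so that goals are real and [lra] and [nra]
    apply; the imaginary part is recovered through [imul] by [Im_inner]. *)
Definition rin (x y : V) : R := Re (inner HS x y).
Definition rscal (a : R) (x : V) : V := vscal HS (mkC a 0) x.
Definition imul (x : V) : V := vscal HS (mkC 0 1) x.

Lemma C_ext (a b : Defs.C) : Re a = Re b -> Im a = Im b -> a = b.
Proof. destruct a, b; simpl; intros; subst; reflexivity. Qed.

Lemma rin_sym x y : rin x y = rin y x.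
Proof. unfold rin. rewrite (inner_conj_sym _ HS y x). reflexivity. Qed.

Lemma rin_add_l x y z : rin (vadd HS x y) z = rin x z + rin y z.
Proof. unfold rin. rewrite inner_add_l. reflexivity. Qed.

Lemma rin_add_r x y z : rin z (vadd HS x y) = rin z x + rin z y.
Proof. rewrite !(rin_sym z). apply rin_add_l. Qed.

Lemma rin_zero_l z : rin (vzero HS) z = 0.
Proof.
  pose proof (rin_add_l (vzero HS) (vzero HS) z) as E.
  rewrite vadd_zero in E. lra.
Qed.

Lemma rin_zero_r z : rin z (vzero HS) = 0.
Proof. rewrite rin_sym. apply rin_zero_l. Qed.

Lemma rin_opp_l x z : rin (vopp HS x) z = - rin x z.
Proof.
  pose proof (rin_add_l x (vopp HS x) z) as E.
  rewrite vadd_opp, rin_zero_l in E. lra.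
Qed.

Lemma rin_sub_l x y z : rin (vsub HS x y) z = rin x z - rin y z.
Proof. unfold vsub. rewrite rin_add_l, rin_opp_l. ring. Qed.

Lemma rin_sub_r x y z : rin z (vsub HS x y) = rin z x - rin z y.
Proof. rewrite !(rin_sym z). apply rin_sub_l. Qed.

Lemma rin_rscal_l a x z : rin (rscal a x) z = a * rin x z.
Proof. unfold rin, rscal. rewrite inner_scal_l. simpl. ring. Qed.

Lemma rin_rscal_r a x z : rin z (rscal a x) = a * rin z x.
Proof. rewrite !(rin_sym z). apply rin_rscal_l. Qed.

Lemma Im_inner x y : Im (inner HS x y) = - rin (imul x) y.
Proof. unfold rin, imul. rewrite inner_scal_l. simpl. ring. Qed.

Lemma rin_imul_r x y : rin x (imul y) = - rin (imul x) y.
Proof.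
  rewrite <- Im_inner, rin_sym.
  replace (rin (imul y) x) with (- Im (inner HS y x)) by (rewrite Im_inner; ring).
  rewrite (inner_conj_sym _ HS x y). simpl. ring.
Qed.

Lemma rin_imul x y : rin (imul x) (imul y) = rin x y.
Proof.
  rewrite rin_imul_r. unfold rin, imul. rewrite !inner_scal_l. simpl. ring.
Qed.

Lemma rin_vscal_l a x y : rin (vscal HS a x) y = Re a * rin x y + Im a * rin (imul x) y.
Proof. unfold rin, imul. rewrite !inner_scal_l. simpl. ring. Qed.

Lemma rin_vscal_r a x y : rin y (vscal HS a x) = Re a * rin y x + Im a * rin y (imul x).
Proof. rewrite !(rin_sym y). apply rin_vscal_l. Qed.

Lemma imul_vscal a x y : rin (imul (vscal HS a x)) y = Re a * rin (imul x) y - Im a * rin x y.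
Proof. unfold rin, imul. rewrite !inner_scal_l. simpl. ring. Qed.

Lemma rin_imul_add x y z : rin (imul (vadd HS x y)) z = rin (imul x) z + rin (imul y) z.
Proof. unfold imul. rewrite vscal_addv. apply rin_add_l. Qed.

Lemma rin_imul_sub x y z : rin (imul (vsub HS x y)) z = rin (imul x) z - rin (imul y) z.
Proof.
  rewrite <- (Ropp_involutive (rin (imul (vsub HS x y)) z)).
  rewrite <- rin_imul_r, rin_sub_l, !rin_imul_r. ring.
Qed.

Lemma rin_imul_rscal a y z : rin (imul (rscal a y)) z = a * rin (imul y) z.
Proof. unfold rscal. rewrite imul_vscal. simpl. ring. Qed.

Lemma inner_eq0 x y : inner HS x y = C0 <-> rin x y = 0 /\ rin (imul x) y = 0.
Proof.
  split.
  - intro E. pose proof (Im_inner x y) as I. unfold rin at 1. rewrite E in *. simpl in *.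
    split; [reflexivity | lra].
  - intros [E1 E2]. apply C_ext; simpl; [exact E1 | rewrite Im_inner, E2; ring].
Qed.

Lemma inner_eq0_sym x y : inner HS x y = C0 -> inner HS y x = C0.
Proof.
  intro E. rewrite (inner_conj_sym _ HS x y), E. apply C_ext; simpl; ring.
Qed.

Lemma rin_pos x : 0 <= rin x x.
Proof. apply inner_pos. Qed.

Lemma rin_eq0 x : rin x x = 0 -> x = vzero HS.
Proof.
  intro E. apply (inner_def _ HS). apply inner_eq0. split; [exact E |].
  pose proof (rin_imul_r x x). rewrite (rin_sym x (imul x)) in H. lra.
Qed.

(** Reduces vector identities to real ones: pair with an arbitrary vector, expand and call
    [ring]. *)
Lemma vec_ext x y : (forall z, rin x z = rin y z) -> x = y.
Proof.
  intro E.
  assert (vsub HS x y = vzero HS) as Z.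
  { apply rin_eq0. rewrite rin_sub_l, E. ring. }
  unfold vsub in Z.
  rewrite <- (vadd_zero _ HS y), <- Z, (vadd_comm _ HS x), vadd_assoc, vadd_opp.
  rewrite vadd_comm, vadd_zero. reflexivity.
Qed.

Lemma norm_sq x : norm HS x * norm HS x = rin x x.
Proof. apply sqrt_sqrt, rin_pos. Qed.

Lemma norm_pos x : 0 <= norm HS x.
Proof. apply sqrt_pos. Qed.

Lemma norm_le x a : 0 <= a -> rin x x <= a * a -> norm HS x <= a.
Proof.
  intros Ha Hx. rewrite <- norm_sq in Hx. pose proof (norm_pos x).
  apply Rsqr_incr_0; unfold Rsqr; assumption.
Qed.

Lemma norm_zero : norm HS (vzero HS) = 0.
Proof.
  apply Rle_antisym; [| apply norm_pos].
  apply norm_le; [lra |]. rewrite rin_zero_l. lra.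
Qed.

Lemma norm_unit x : rin x x = 1 -> norm HS x = 1.
Proof. intro E. unfold norm. fold (rin x x). rewrite E. apply sqrt_1. Qed.

Lemma norm_gt0 x : x <> vzero HS -> 0 < norm HS x.
Proof.
  intro Hx. destruct (norm_pos x) as [H | H]; [exact H |].
  exfalso. apply Hx, rin_eq0. rewrite <- norm_sq, <- H. ring.
Qed.

Lemma cauchy_schwarz x y : Rabs (rin x y) <= norm HS x * norm HS y.
Proof.
  pose proof (norm_pos x). pose proof (norm_pos y).
  destruct (classic (y = vzero HS)) as [-> | Hy].
  { rewrite rin_zero_r, Rabs_R0. nra. }
  pose proof (norm_gt0 y Hy) as Py.
  apply Rsqr_incr_0; [| apply Rabs_pos | nra].
  rewrite <- Rsqr_abs. unfold Rsqr.
  (* The squared norm of |y|^2 x - <x,y> y is |y|^2 (|x|^2 |y|^2 - <x,y>^2). *)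
  pose proof (rin_pos (vsub HS (rscal (rin y y) x) (rscal (rin x y) y))) as P.
  rewrite rin_sub_l, !rin_sub_r, !rin_rscal_l, !rin_rscal_r, (rin_sym y x) in P.
  replace (norm HS x * norm HS y * (norm HS x * norm HS y))
    with (rin x x * rin y y) by (rewrite <- !norm_sq; ring).
  assert (0 < rin y y) by (rewrite <- norm_sq; nra).
  apply Rmult_le_reg_l with (rin y y); [assumption |]. lra.
Qed.

Lemma norm_add x y : norm HS (vadd HS x y) <= norm HS x + norm HS y.
Proof.
  pose proof (norm_pos x). pose proof (norm_pos y).
  apply norm_le; [lra |].
  rewrite rin_add_l, !rin_add_r, (rin_sym y x), <- !norm_sq.
  pose proof (cauchy_schwarz x y). pose proof (Rle_abs (rin x y)). lra.
Qed.

Lemma norm_rscal a x : norm HS (rscal a x) = Rabs a * norm HS x.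
Proof.
  unfold norm. fold (rin (rscal a x) (rscal a x)) (rin x x).
  rewrite rin_rscal_l, rin_rscal_r, <- Rmult_assoc.
  rewrite sqrt_mult; [| nra | apply rin_pos].
  f_equal. apply sqrt_Rsqr_abs.
Qed.

Lemma norm_sub_sym x y : norm HS (vsub HS x y) = norm HS (vsub HS y x).
Proof.
  unfold norm. f_equal.
  fold (rin (vsub HS x y) (vsub HS x y)) (rin (vsub HS y x) (vsub HS y x)).
  rewrite !rin_sub_l, !rin_sub_r. ring.
Qed.

Lemma norm_sub_triangle y x z :
  norm HS (vsub HS x z) <= norm HS (vsub HS x y) + norm HS (vsub HS y z).
Proof.
  replace (vsub HS x z) with (vadd HS (vsub HS x y) (vsub HS y z)); [apply norm_add |].
  apply vec_ext. intro w. rewrite rin_add_l, !rin_sub_l. ring.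
Qed.

Lemma norm_le_sub x y : norm HS x <= norm HS y + norm HS (vsub HS x y).
Proof.
  replace x with (vadd HS y (vsub HS x y)) at 1; [apply norm_add |].
  apply vec_ext. intro w. rewrite rin_add_l, !rin_sub_l. ring.
Qed.

Lemma le_of_forall_eps (a b : R) : (forall eps, 0 < eps -> a <= b + eps) -> a <= b.
Proof.
  intro H. destruct (Rle_or_lt a b) as [L | L]; [exact L |].
  specialize (H ((a - b) / 2)). lra.
Qed.

Lemma geometric_small (B q eps : R) :
  0 <= B -> 0 <= q < 1 -> 0 < eps -> exists N, forall n, (N <= n)%nat -> B * q ^ n < eps.
Proof.
  intros HB Hq He. destruct (pow_lt_1_zero q) with (y := eps / (B + 1)) as [N HN].
  - rewrite Rabs_right; lra.
  - apply Rdiv_lt_0_compat; lra.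
  - exists N. intros n Hn. specialize (HN n Hn).
    assert (0 <= q ^ n) by (apply pow_le; lra).
    rewrite Rabs_right in HN by lra.
    assert (eps = eps / (B + 1) * (B + 1)) as E by (field; lra).
    rewrite E. nra.
Qed.

Lemma geometric_converges (u : nat -> V) (A q : R) :
  0 <= q < 1 ->
  (forall n, norm HS (vsub HS (u (S n)) (u n)) <= A * q ^ n) ->
  exists l, converges_to HS u l /\
    forall n, norm HS (vsub HS l (u n)) <= A / (1 - q) * q ^ n.
Proof.
  intros Hq Hu.
  assert (HA : 0 <= A).
  { specialize (Hu 0%nat). simpl in Hu.
    pose proof (norm_pos (vsub HS (u 1%nat) (u 0%nat))). lra. }
  set (B := A / (1 - q)).
  assert (HB : 0 <= B).
  { unfold B, Rdiv. pose proof (Rinv_0_lt_compat (1 - q)). nra. }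
  assert (AB : A = B * (1 - q)) by (unfold B; field; lra).
  (* The bound is the exact partial sum of the geometric series, which makes the induction on [k]
     close. *)
  assert (Hd : forall n k, norm HS (vsub HS (u (n + k)%nat) (u n)) <= B * q ^ n * (1 - q ^ k)).
  { intros n k. induction k as [| k IH].
    - rewrite Nat.add_0_r. simpl.
      replace (vsub HS (u n) (u n)) with (vzero HS).
      + rewrite norm_zero. lra.
      + apply vec_ext. intro. rewrite rin_sub_l, rin_zero_l. ring.
    - rewrite Nat.add_succ_r.
      pose proof (norm_sub_triangle (u (n + k)%nat) (u (S (n + k))) (u n)).
      specialize (Hu (n + k)%nat). rewrite pow_add, AB in Hu. simpl. nra. }
  assert (Hd' : forall n m, (n <= m)%nat -> norm HS (vsub HS (u m) (u n)) <= B * q ^ n).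
  { intros n m L. specialize (Hd n (m - n)%nat).
    replace (n + (m - n))%nat with m in Hd by lia.
    assert (0 <= q ^ n) by (apply pow_le; lra).
    assert (0 <= q ^ (m - n)) by (apply pow_le; lra).
    assert (0 <= B * q ^ n) by nra. nra. }
  assert (Hs := fun eps => geometric_small B q eps HB Hq).
  destruct (complete _ HS u) as [l Hl].
  - intros eps He. destruct (Hs eps He) as [N HN]. exists N. intros m n Hm Hn.
    change (norm HS (vsub HS (u m) (u n)) < eps).
    destruct (Nat.le_ge_cases m n) as [L | L].
    + rewrite norm_sub_sym. eapply Rle_lt_trans; [apply Hd', L | apply HN, Hm].
    + eapply Rle_lt_trans; [apply Hd', L | apply HN, Hn].
  - exists l. split; [exact Hl |]. intro n.
    apply le_of_forall_eps. intros eps He.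
    destruct (Hl eps He) as [N HN].
    specialize (HN (max N n) (Nat.le_max_l _ _)).
    change (norm HS (vsub HS (u (max N n)) l) < eps) in HN.
    pose proof (norm_sub_triangle (u (max N n)) l (u n)) as Tr.
    rewrite norm_sub_sym in HN.
    pose proof (Hd' n (max N n) (Nat.le_max_r _ _)). lra.
Qed.

Lemma manifold_sub M x y : linear_manifold HS M -> M x -> M y -> M (vsub HS x y).
Proof.
  intros [_ [Ha Hs]] Mx My.
  replace (vsub HS x y) with (vadd HS x (rscal (-1) y)).
  - apply Ha; [exact Mx | apply Hs, My].
  - apply vec_ext. intro. rewrite rin_add_l, rin_sub_l, rin_rscal_l. ring.
Qed.

(* The distance to [M] is approached at rate [2^-n], so that the parallelogram law makes the
   minimizing sequence geometrically Cauchy. *)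
Lemma minimizer (M : V -> Prop) (x : V) :
  subspace HS M ->
  exists p, M p /\ forall m, M m -> rin (vsub HS x p) (vsub HS x p) <= rin (vsub HS x m) (vsub HS x m).
Proof.
  intros [LM CM]. pose proof LM as [M0 [Ma Ms]].
  (* [completeness] yields suprema, hence the negation: [- s] is the infimum of the squared
     distances. *)
  destruct (completeness (fun r => exists m, M m /\ r = - rin (vsub HS x m) (vsub HS x m)))
    as [s [Ub Lub]].
  - exists 0. intros r [m [_ ->]]. pose proof (rin_pos (vsub HS x m)). lra.
  - exists (- rin (vsub HS x (vzero HS)) (vsub HS x (vzero HS))), (vzero HS). auto.
  - assert (Hd : forall m, M m -> - s <= rin (vsub HS x m) (vsub HS x m)).
    { intros m Mm.
      assert (- rin (vsub HS x m) (vsub HS x m) <= s) by (apply Ub; exists m; auto). lra. }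
    assert (Ex : forall n, exists m, M m /\ rin (vsub HS x m) (vsub HS x m) <= - s + (1/4) ^ n).
    { intro n. apply NNPP. intro H.
      assert (0 < (1/4) ^ n) by (apply pow_lt; lra).
      assert (s <= s - (1/4) ^ n); [| lra].
      apply Lub. intros r [m [Mm ->]].
      destruct (Rle_or_lt (rin (vsub HS x m) (vsub HS x m)) (- s + (1/4) ^ n)); [| lra].
      exfalso. apply H. exists m. auto. }
    apply functional_choice in Ex as [u Hu].
    destruct (geometric_converges u 2 (1/2)) as [p [Cp Hp]]; [lra | |].
    + intro n. destruct (Hu n) as [M1 H1], (Hu (S n)) as [M2 H2].
      assert (E : (1/4) ^ n = (1/2) ^ n * (1/2) ^ n)
        by (rewrite <- Rpow_mult_distr; f_equal; lra).
      assert (0 < (1/2) ^ n) by (apply pow_lt; lra).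
      apply norm_le; [lra |].
      (* The midpoint lies in [M], so its squared distance is at least [- s]; the parallelogram law
         then bounds the squared step by 2 (4^-n + 4^-(n+1)), below (2 * 2^-n)^2. *)
      specialize (Hd (rscal (1/2) (vadd HS (u n) (u (S n)))) (Ms _ _ (Ma _ _ M1 M2))).
      rewrite !rin_sub_l, !rin_sub_r in *.
      rewrite !rin_rscal_l, !rin_rscal_r, !rin_add_l, !rin_add_r in Hd.
      rewrite !(rin_sym (u n) x), !(rin_sym (u (S n)) x), !(rin_sym (u (S n)) (u n)) in *.
      assert (0 < (1/4) ^ n) by (apply pow_lt; lra). simpl in H2. lra.
    + exists p. split; [eapply CM; [| exact Cp]; intro n; apply Hu |].
      intros m Mm. specialize (Hd m Mm).
      apply Rle_trans with (- s); [| exact Hd].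
      assert (Ps : 0 <= - s).
      { apply Ropp_0_ge_le_contravar, Rle_ge, Lub.
        intros r [k [_ ->]]. pose proof (rin_pos (vsub HS x k)). lra. }
      (* The constant 5 below adds |x - u_N| <= sqrt(-s) + 2^-N and |u_N - p| <= 4 * 2^-N. *)
      rewrite <- (sqrt_sqrt (- s) Ps), <- norm_sq.
      apply Rmult_le_compat; try apply norm_pos;
      (apply le_of_forall_eps; intros eps He;
       destruct (geometric_small 5 (1/2) eps) as [N HN]; [lra | lra | lra |];
       specialize (HN N (le_n N));
       assert (0 < (1/2) ^ N) by (apply pow_lt; lra);
       pose proof (norm_sub_triangle (u N) x p);
       specialize (Hp N); rewrite norm_sub_sym in Hp;
       destruct (Hu N) as [_ HuN];
       assert (norm HS (vsub HS x (u N)) <= sqrt (- s) + (1/2) ^ N);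
       [ apply norm_le; [pose proof (sqrt_pos (- s)); lra |];
         pose proof (sqrt_pos (- s)); pose proof (sqrt_sqrt (- s) Ps);
         assert ((1/4) ^ N = (1/2) ^ N * (1/2) ^ N)
           by (rewrite <- Rpow_mult_distr; f_equal; lra);
         nra
       | lra ]).
Qed.

Lemma projection (M : V -> Prop) (x : V) :
  subspace HS M -> exists p, M p /\ ortho HS M (vsub HS x p).
Proof.
  intros SM. destruct (minimizer M x SM) as [p [Mp Hp]].
  destruct SM as [[M0 [Ma Ms]] _]. exists p. split; [exact Mp |].
  assert (H : forall m, M m -> rin (vsub HS x p) m = 0).
  { intros m Mm.
    set (k := rin (vsub HS x p) m). set (w := rin m m).
    assert (Pw : 0 <= w) by apply rin_pos.
    (* Moving [p] by [t] along [m] cannot decrease the distance, which gives t^2 (w + 2) <= 0. The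
       denominator [w + 1] avoids a separate case for m = 0. *)
    set (t := k / (w + 1)).
    specialize (Hp (vadd HS p (rscal t m)) (Ma _ _ Mp (Ms _ _ Mm))).
    replace (vsub HS x (vadd HS p (rscal t m))) with (vsub HS (vsub HS x p) (rscal t m)) in Hp.
    - rewrite !rin_sub_l, !rin_sub_r, !rin_rscal_l, !rin_rscal_r in Hp.
      rewrite (rin_sym m x), (rin_sym m p) in Hp.
      assert (k = rin x m - rin p m) as Ek by (unfold k; apply rin_sub_l).
      fold w in Hp.
      assert (k = t * (w + 1)) as Et by (unfold t; field; lra).
      assert (2 * t * k <= t * t * w) by (rewrite Ek; lra).
      assert (t * t * (w + 2) <= 0) by (rewrite Et in H; lra).
      assert (t * t = 0) by nra.
      assert (t = 0) by nra. rewrite Et, H2. ring.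
    - apply vec_ext. intro. rewrite !rin_sub_l, rin_add_l. ring. }
  intros m Mm. apply inner_eq0. split; [exact (H m Mm) |].
  rewrite <- (Ropp_involutive (rin (imul (vsub HS x p)) m)), <- rin_imul_r.
  rewrite (H (imul m) (Ms _ _ Mm)). ring.
Qed.

(* The term [j] is singled out to allow exact evaluations, with [A = 0]. *)
Lemma series_sum (g : nat -> V) (c : nat -> R) :
  (forall i, rin (g i) (g i) = 1) -> (forall i, Rabs (c i) <= (1/2) ^ i) ->
  exists t, forall y A j,
    (forall i, i <> j -> Rabs (c i * rin (g i) y) <= A * (1/2) ^ i) ->
    Rabs (rin t y - c j * rin (g j) y) <= 2 * A.
Proof.
  intros Hg Hc.
  set (u := fix u n := match n with O => vzero HS | S k => vadd HS (u k) (rscal (c k) (g k)) end).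
  destruct (geometric_converges u 1 (1/2)) as [t [_ Ht]]; [lra | |].
  - intro n. replace (vsub HS (u (S n)) (u n)) with (rscal (c n) (g n)).
    + rewrite norm_rscal, norm_unit by apply Hg. rewrite Rmult_1_r, Rmult_1_l. apply Hc.
    + apply vec_ext. intro. simpl. rewrite rin_sub_l, rin_add_l. ring.
  - exists t. intros y A j HA.
    assert (PA : 0 <= A).
    { specialize (HA (S j) (Nat.neq_succ_diag_l j)).
      assert (0 < (1/2) ^ S j) by (apply pow_lt; lra).
      pose proof (Rabs_pos (c (S j) * rin (g (S j)) y)). nra. }
    (* The term [j] is subtracted only once the partial sum contains it; the others add up to at
       most a partial geometric sum. *)
    assert (Hp : forall n, Rabs (rin (u n) y - (if (j <? n)%nat then c j * rin (g j) y else 0))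
                    <= A * (2 - 2 * (1/2) ^ n)).
    { induction n as [| n IH].
      - simpl. rewrite rin_zero_l, Rminus_0_r, Rabs_R0. lra.
      - simpl u. rewrite rin_add_l, rin_rscal_l.
        assert (0 < (1/2) ^ n) by (apply pow_lt; lra).
        destruct (Nat.eq_dec n j) as [-> | Hn].
        + rewrite Nat.ltb_irrefl in IH.
          replace (j <? S j)%nat with true by (symmetry; apply Nat.ltb_lt; lia).
          replace (rin (u j) y + c j * rin (g j) y - c j * rin (g j) y) with (rin (u j) y - 0) by ring.
          simpl. nra.
        + replace (j <? S n)%nat with (j <? n)%nat.
          * specialize (HA n Hn).
            pose proof (Rabs_triang (rin (u n) y - (if (j <? n)%nat then c j * rin (g j) y else 0))
                          (c n * rin (g n) y)) as Tr.
            match goal with |- Rabs ?a <= _ => match type of Tr with Rabs ?b <= _ =>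
              replace a with b by ring end end.
            simpl. lra.
          * destruct (Nat.ltb_spec j n), (Nat.ltb_spec j (S n)); try reflexivity; lia. }
    apply le_of_forall_eps. intros eps He.
    pose proof (norm_pos y) as Py.
    destruct (geometric_small (2 * norm HS y) (1/2) eps) as [N HN]; [lra | lra | lra |].
    set (n := max N (S j)). specialize (HN n (Nat.le_max_l _ _)).
    specialize (Hp n). specialize (Ht n).
    replace (j <? n)%nat with true in Hp by (symmetry; apply Nat.ltb_lt; lia).
    assert (0 < (1/2) ^ n) by (apply pow_lt; lra).
    pose proof (cauchy_schwarz (vsub HS t (u n)) y) as CS. rewrite rin_sub_l in CS.
    pose proof (Rabs_triang (rin t y - rin (u n) y) (rin (u n) y - c j * rin (g j) y)) as Tr.
    replace (rin t y - rin (u n) y + (rin (u n) y - c j * rin (g j) y))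
      with (rin t y - c j * rin (g j) y) in Tr by ring.
    assert (norm HS (vsub HS t (u n)) * norm HS y <= 2 * (1/2) ^ n * norm HS y)
      by (apply Rmult_le_compat_r; [exact Py | lra]).
    nra.
Qed.

End RealInnerProduct.

(** * Unit vectors that are small on the graph of a closed unbounded operator *)

Section ClosedOperator.
Context {V : Type} (HS : HilbertSpace V) (dom : V -> Prop) (T : V -> V).
Context (lin : linear_operator HS dom T).

Definition graph_sq (x : V) : R := rin HS x x + rin HS (T x) (T x).

Definition small_on_graph (eps : R) (f : V) : Prop :=
  forall x, dom x -> graph_sq x <= 1 -> Rabs (rin HS x f) <= eps.

(** Up to normalizing [f] and changing the sign of [x], this is what remains when, for some [eps],
    no unit vector orthogonal to [l] satisfies [small_on_graph]. *)
Definition coercive_off (l : list V) : Prop :=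
  exists c, 0 < c /\
    forall f, (forall v, In v l -> rin HS f v = 0) ->
      exists x, dom x /\ graph_sq x <= 1 /\ c * norm HS f <= rin HS x f.

Fixpoint real_orthonormal (l : list V) : Prop :=
  match l with
  | nil => True
  | v :: l' => rin HS v v = 1 /\ (forall w, In w l' -> rin HS v w = 0) /\ real_orthonormal l'
  end.

Lemma dom_zero : dom (vzero HS).
Proof. apply lin. Qed.

Lemma dom_add x y : dom x -> dom y -> dom (vadd HS x y).
Proof. apply lin. Qed.

Lemma dom_vscal a x : dom x -> dom (vscal HS a x).
Proof. apply lin. Qed.

Lemma dom_rscal a x : dom x -> dom (rscal HS a x).
Proof. apply dom_vscal. Qed.

Lemma T_rscal a x : dom x -> T (rscal HS a x) = rscal HS a (T x).
Proof. apply lin. Qed.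

Lemma T_add x y : dom x -> dom y -> T (vadd HS x y) = vadd HS (T x) (T y).
Proof. apply lin. Qed.

Lemma graph_sq_pos x : 0 <= graph_sq x.
Proof. unfold graph_sq. pose proof (rin_pos HS x). pose proof (rin_pos HS (T x)). lra. Qed.

Lemma graph_sq_rscal a x : dom x -> graph_sq (rscal HS a x) = a * a * graph_sq x.
Proof.
  intro Dx. unfold graph_sq. rewrite T_rscal by exact Dx.
  rewrite !rin_rscal_l, !rin_rscal_r. ring.
Qed.

(** The factor 1/(1 + g), with g the squared graph norm, needs no square root and no case x = 0. *)
Lemma graph_sq_normalize x : dom x -> graph_sq (rscal HS (/ (1 + graph_sq x)) x) <= 1.
Proof.
  intro Dx. pose proof (graph_sq_pos x) as P.
  rewrite graph_sq_rscal by exact Dx.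
  assert (I : 0 < / (1 + graph_sq x)) by (apply Rinv_0_lt_compat; lra).
  assert (E : / (1 + graph_sq x) * (1 + graph_sq x) = 1) by (field; lra).
  set (k := / (1 + graph_sq x)) in *. nra.
Qed.

Lemma norm_le_graph x : graph_sq x <= 1 -> norm HS x <= 1.
Proof.
  unfold graph_sq. intro H. pose proof (rin_pos HS (T x)). apply norm_le; lra.
Qed.

(** One constant per [x] serves all [eps] and [f], so the coefficients of [x] inherit the decay rate
    of a whole sequence. *)
Lemma small_on_graph_bound x :
  dom x -> exists C, 0 <= C /\ forall eps f, small_on_graph eps f -> Rabs (rin HS x f) <= C * eps.
Proof.
  intro Dx. pose proof (graph_sq_pos x) as P. exists (1 + graph_sq x). split; [lra |].
  intros eps f Hf.
  specialize (Hf _ (dom_rscal (/ (1 + graph_sq x)) x Dx) (graph_sq_normalize x Dx)).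
  rewrite rin_rscal_l, Rabs_mult, (Rabs_right (/ _)) in Hf
    by (apply Rle_ge, Rlt_le, Rinv_0_lt_compat; lra).
  apply (Rmult_le_compat_l (1 + graph_sq x)) in Hf; [| lra].
  rewrite <- Rmult_assoc, Rinv_r, Rmult_1_l in Hf by lra. exact Hf.
Qed.

(* Greedy approximation, the core of the open mapping theorem: subtracting from the error [e] a
   multiple of a graph-bounded [x] correlated with [e] shrinks [e] by a fixed factor, so every
   vector is the sum of a series that converges in the graph norm. *)
Lemma coercive_nil_bounded :
  closed_operator HS dom T -> coercive_off nil ->
  exists C, forall x, dom x -> norm HS (T x) <= C * norm HS x.
Proof.
  intros cl [c0 [Hc0 Hx]].
  (* The cap keeps 1 - c^2 positive and below 1, so [q] below is a contraction factor. *)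
  set (c := Rmin c0 (1/2)).
  assert (Hc : 0 < c <= 1/2).
  { unfold c. split; [apply Rmin_glb_lt; lra | apply Rmin_r]. }
  assert (Hcc : c <= c0) by apply Rmin_l.
  assert (EX : forall f, exists x, dom x /\ graph_sq x <= 1 /\ c * norm HS f <= rin HS x f).
  { intro f. destruct (Hx f) as [x [D [G I]]]; [intros v [] |].
    exists x. repeat split; auto. pose proof (norm_pos HS f). nra. }
  apply functional_choice in EX as [X HX].
  set (q := sqrt (1 - c * c)).
  assert (Hqq : q * q = 1 - c * c) by (apply sqrt_sqrt; nra).
  assert (Hq : 0 <= q < 1).
  { split; [apply sqrt_pos |]. pose proof (sqrt_pos (1 - c * c)). fold q in H. nra. }
  exists (c / (1 - q)). intros v _.
  set (w := fix w n := match n with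
    | O => vzero HS
    | S k => vadd HS (w k) (rscal HS (c * norm HS (vsub HS v (w k))) (X (vsub HS v (w k)))) end).
  assert (Dw : forall n, dom (w n)).
  { induction n; [exact dom_zero |]. apply dom_add; [exact IHn | apply dom_rscal, HX]. }
  assert (Ew : forall n, norm HS (vsub HS v (w n)) <= norm HS v * q ^ n).
  { induction n as [| n IH].
    - simpl. replace (vsub HS v (vzero HS)) with v; [lra |].
      apply vec_ext with HS. intro. rewrite rin_sub_l, rin_zero_l. ring.
    - apply Rle_trans with (norm HS (vsub HS v (w n)) * q); [| simpl; nra].
      pose proof (norm_pos HS (vsub HS v (w n))) as Pe.
      apply norm_le; [nra |].
      set (e := vsub HS v (w n)) in *. destruct (HX e) as [_ [G I]].
      replace (vsub HS v (w (S n))) with (vsub HS e (rscal HS (c * norm HS e) (X e))).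
      (* With k = c |e|, the new squared error is at most |e|^2 - 2 k^2 + k^2 = (1 - c^2) |e|^2. *)
      + rewrite rin_sub_l, !rin_sub_r, !rin_rscal_l, !rin_rscal_r, (rin_sym HS e (X e)).
        replace (norm HS e * q * (norm HS e * q)) with (norm HS e * norm HS e * (q * q)) by ring.
        rewrite Hqq, <- (norm_sq HS e).
        unfold graph_sq in G. pose proof (rin_pos HS (T (X e))). pose proof (rin_pos HS (X e)).
        assert (0 <= c * norm HS e) as Pc by nra.
        set (k := c * norm HS e) in *.
        assert (k * k <= k * rin HS (X e) e) by (apply Rmult_le_compat_l; assumption).
        assert (k * k * rin HS (X e) (X e) <= k * k * 1) by (apply Rmult_le_compat_l; nra).
        assert (k * k = c * c * (norm HS e * norm HS e)) by (unfold k; ring). lra.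
      + apply vec_ext with HS. intro. unfold e. simpl. rewrite !rin_sub_l, rin_add_l. unfold e. ring. }
  assert (T0 : T (vzero HS) = vzero HS).
  { replace (vzero HS) with (rscal HS 0 (vzero HS)) at 1.
    - rewrite T_rscal by exact dom_zero. apply vec_ext with HS. intro.
      rewrite rin_rscal_l, rin_zero_l. ring.
    - apply vec_ext with HS. intro. rewrite rin_rscal_l, rin_zero_l. ring. }
  destruct (geometric_converges HS (fun n => T (w n)) (c * norm HS v) q Hq) as [l [Cl Bl]].
  { intro n. simpl. destruct (HX (vsub HS v (w n))) as [D [G _]].
    rewrite T_add, T_rscal by auto using dom_rscal.
    set (e := vsub HS v (w n)) in *.
    replace (vsub HS _ _) with (rscal HS (c * norm HS e) (T (X e))).
    - rewrite norm_rscal, Rabs_right by (pose proof (norm_pos HS e); nra).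
      specialize (Ew n). fold e in Ew.
      assert (norm HS (T (X e)) <= 1).
      { apply norm_le; [lra |]. unfold graph_sq in G. pose proof (rin_pos HS (X e)). lra. }
      pose proof (norm_pos HS e). pose proof (norm_pos HS (T (X e))).
      assert (norm HS e * norm HS (T (X e)) <= norm HS v * q ^ n * 1)
        by (apply Rmult_le_compat; assumption).
      nra.
    - apply vec_ext with HS. intro. rewrite rin_sub_l, rin_add_l. ring. }
  (* Closedness identifies the limit of [T (w n)] with [T v]; the geometric bound at index 0, where
     [w 0] is zero, then bounds |T v|. *)
  destruct (cl w v l Dw) as [_ Tv]; [| exact Cl |].
  - intros eps He.
    destruct (geometric_small (norm HS v) q eps (norm_pos HS v) Hq He) as [N HN].
    exists N. intros n Hn. rewrite norm_sub_sym. eapply Rle_lt_trans; [apply Ew | apply HN, Hn].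
  - specialize (Bl 0%nat). simpl in Bl. rewrite T0 in Bl. rewrite Tv.
    replace (vsub HS l (vzero HS)) with l in Bl.
    + unfold Rdiv in *. lra.
    + apply vec_ext with HS. intro. rewrite rin_sub_l, rin_zero_l. ring.
Qed.

(** If [f] has a small component along [v], removing it barely changes [f] and the given coercivity
    applies. Otherwise [f] correlates with [v], hence with a vector [d] of the domain near [v]. *)
Lemma coercive_off_cons v l :
  dense HS dom -> real_orthonormal (v :: l) -> coercive_off (v :: l) -> coercive_off l.
Proof.
  intros de [Nv [Ov _]] [c0 [Hc0 Hx]].
  set (c := Rmin c0 1).
  assert (Hc : 0 < c <= 1).
  { unfold c. split; [apply Rmin_glb_lt; lra | apply Rmin_r]. }
  assert (Hcc : c <= c0) by apply Rmin_l.
  (* The first case loses at most c dl + dl <= 2 dl = c/2 of the constant; in the second, [d] is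
     within dl/2 of [v], so half the correlation survives. *)
  set (dl := c / 4).
  destruct (de v (dl / 2)) as [d [Dd Hd]]; [unfold dl; lra |].
  pose proof (graph_sq_normalize d Dd) as Gd.
  assert (HG : 0 < / (1 + graph_sq d)).
  { apply Rinv_0_lt_compat. pose proof (graph_sq_pos d). lra. }
  set (G := / (1 + graph_sq d)) in *.
  assert (Hdl : 0 < dl <= 1/4) by (unfold dl; lra).
  exists (Rmin (c / 2) (dl / 2 * G)). split; [apply Rmin_glb_lt; nra |].
  pose proof (Rmin_l (c / 2) (dl / 2 * G)) as M1.
  pose proof (Rmin_r (c / 2) (dl / 2 * G)) as M2.
  set (c' := Rmin (c / 2) (dl / 2 * G)) in *.
  intros f Of. pose proof (norm_pos HS f) as Pf.
  set (a := rin HS f v).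
  destruct (Rle_or_lt (Rabs a) (dl * norm HS f)) as [La | La].
  - set (p := vsub HS f (rscal HS a v)).
    destruct (Hx p) as [x [Dx [Gx Ix]]].
    { intros w [<- | Hw]; unfold p; rewrite rin_sub_l, rin_rscal_l.
      - rewrite Nv. unfold a. ring.
      - rewrite (Ov w Hw), (Of w Hw). ring. }
    exists x. split; [exact Dx | split; [exact Gx |]].
    assert (Lp : norm HS f <= norm HS p + Rabs a).
    { pose proof (norm_le_sub HS f p) as L.
      replace (vsub HS f p) with (rscal HS a v) in L.
      - rewrite norm_rscal, (norm_unit HS v Nv) in L. lra.
      - apply vec_ext with HS. intro. unfold p. rewrite !rin_sub_l. ring. }
    unfold p in Ix. rewrite rin_sub_r, rin_rscal_r in Ix. fold p in Ix.
    pose proof (norm_pos HS p).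
    assert (Rabs (a * rin HS x v) <= Rabs a).
    { rewrite Rabs_mult. pose proof (cauchy_schwarz HS x v) as CS.
      rewrite (norm_unit HS v Nv) in CS. pose proof (norm_le_graph x Gx).
      pose proof (Rabs_pos a). pose proof (Rabs_pos (rin HS x v)). nra. }
    pose proof (Rle_abs (- (a * rin HS x v))) as Ra. rewrite Rabs_Ropp in Ra.
    assert (c * norm HS p <= c0 * norm HS p) by nra.
    assert (c * (norm HS f - dl * norm HS f) <= c * norm HS p) by (apply Rmult_le_compat_l; lra).
    assert (c' * norm HS f <= c / 2 * norm HS f) by (apply Rmult_le_compat_r; lra).
    assert (c * dl * norm HS f <= 1 * dl * norm HS f)
      by (apply Rmult_le_compat_r; [lra | apply Rmult_le_compat_r; lra]).
    assert (dl * norm HS f = c * norm HS f / 4) by (unfold dl; field).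
    lra.
  - assert (Ld : dl / 2 * norm HS f <= Rabs (rin HS d f)).
    { pose proof (cauchy_schwarz HS (vsub HS v d) f) as CS. rewrite rin_sub_l in CS.
      rewrite (rin_sym HS v f) in CS. fold a in CS.
      pose proof (Rabs_triang (a - rin HS d f) (rin HS d f)) as Tr.
      replace (a - rin HS d f + rin HS d f) with a in Tr by ring.
      assert (norm HS (vsub HS v d) * norm HS f <= dl / 2 * norm HS f)
        by (apply Rmult_le_compat_r; lra).
      lra. }
    assert (Hs : exists s, s * s = 1 /\ s * rin HS d f = Rabs (rin HS d f)).
    { destruct (Rle_or_lt 0 (rin HS d f)).
      - exists 1. rewrite Rabs_right; lra.
      - exists (-1). rewrite Rabs_left; lra. }
    destruct Hs as [s [Hs1 Hs2]].
    exists (rscal HS s (rscal HS G d)). repeat split.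
    + apply dom_rscal, dom_rscal, Dd.
    + rewrite graph_sq_rscal, Hs1 by apply dom_rscal, Dd. lra.
    + rewrite !rin_rscal_l.
      replace (s * (G * rin HS d f)) with (G * Rabs (rin HS d f)) by (rewrite <- Hs2; ring).
      assert (c' * norm HS f <= dl / 2 * G * norm HS f) by (apply Rmult_le_compat_r; lra).
      assert (G * (dl / 2 * norm HS f) <= G * Rabs (rin HS d f))
        by (apply Rmult_le_compat_l; lra).
      lra.
Qed.

Lemma coercive_off_nil l :
  dense HS dom -> real_orthonormal l -> coercive_off l -> coercive_off nil.
Proof.
  intro de. induction l as [| v l IH]; [auto |].
  intros O Co. apply IH; [apply O | eapply coercive_off_cons; eauto].
Qed.

(** Otherwise [l] is coercive with constant [eps]; discarding its vectors one by one makes the empty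
    list coercive, and then [T] is bounded. *)
Lemma exists_small l eps :
  closed_operator HS dom T -> unbounded_operator HS dom T -> dense HS dom ->
  real_orthonormal l -> 0 < eps ->
  exists f, rin HS f f = 1 /\ (forall v, In v l -> rin HS f v = 0) /\ small_on_graph eps f.
Proof.
  intros cl unb de O He. apply NNPP. intro N. apply unb.
  apply coercive_nil_bounded; [exact cl |].
  apply (coercive_off_nil l de O).
  exists eps. split; [exact He |]. intros f Of.
  destruct (classic (f = vzero HS)) as [-> | Nf].
  - exists (vzero HS). pose proof dom_zero as D. split; [exact D |].
    rewrite norm_zero, rin_zero_l. split; [| lra].
    replace (vzero HS) with (rscal HS 0 (vzero HS)).
    + rewrite graph_sq_rscal by exact D. lra.
    + apply vec_ext with HS. intro. rewrite rin_rscal_l, rin_zero_l. ring.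
  - pose proof (norm_gt0 HS f Nf) as P.
    set (k := / norm HS f).
    assert (Ek : norm HS f * k = 1) by (apply Rinv_r; lra).
    assert (Pk : 0 < k) by (apply Rinv_0_lt_compat, P).
    apply NNPP. intro N2. apply N. exists (rscal HS k f). split; [| split].
    + rewrite rin_rscal_l, rin_rscal_r, <- norm_sq.
      replace (k * (k * (norm HS f * norm HS f))) with (norm HS f * k * (norm HS f * k)) by ring.
      rewrite Ek. ring.
    + intros v Hv. rewrite rin_rscal_l, (Of v Hv). ring.
    + intros x Dx Gx. rewrite rin_rscal_r.
      destruct (Rle_or_lt (Rabs (k * rin HS x f)) eps) as [L | L]; [exact L |].
      exfalso. apply N2. rewrite Rabs_mult, (Rabs_right k) in L by lra.
      assert (L2 : eps * norm HS f <= Rabs (rin HS x f)).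
      { apply (Rmult_lt_compat_r (norm HS f)) in L; [| exact P].
        replace (k * Rabs (rin HS x f) * norm HS f)
          with (norm HS f * k * Rabs (rin HS x f)) in L by ring.
        rewrite Ek in L. lra. }
      destruct (Rle_or_lt 0 (rin HS x f)).
      * exists x. rewrite Rabs_right in L2 by lra. auto.
      * exists (rscal HS (-1) x). rewrite Rabs_left in L2 by lra.
        rewrite graph_sq_rscal, rin_rscal_l by exact Dx.
        split; [apply dom_rscal, Dx |]. split; lra.
Qed.

End ClosedOperator.

(** * An orthonormal basis adapted to the domain *)

Section AdaptedBasis.
Context {V : Type} (HS : HilbertSpace V) (dom : V -> Prop) (T : V -> V).

Fixpoint orthonormal (l : list V) : Prop :=
  match l with
  | nil => True
  | v :: l' => rin HS v v = 1 /\ (forall w, In w l' -> inner HS v w = C0) /\ orthonormal l'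
  end.

(** Orthogonality to v and i v for [rin] amounts to orthogonality to v for [inner], so real results
    about lists apply to complex ones. *)
Definition realify (l : list V) : list V := flat_map (fun v => v :: imul HS v :: nil) l.

Lemma rin_self_imul x : rin HS (imul HS x) x = 0.
Proof. pose proof (rin_imul_r HS x x) as E. rewrite (rin_sym HS x) in E. lra. Qed.

Lemma in_realify u l : In u (realify l) -> exists v, In v l /\ (u = v \/ u = imul HS v).
Proof.
  unfold realify. rewrite in_flat_map. intros [v [Hv [<- | [<- | []]]]]; eauto.
Qed.

Lemma real_orthonormal_realify l : orthonormal l -> real_orthonormal HS (realify l).
Proof.
  induction l as [| v l IH]; simpl; [auto |]. intros [N [O Ol]].
  assert (E : forall u, In u (realify l) -> rin HS v u = 0 /\ rin HS (imul HS v) u = 0).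
  { intros u Hu. destruct (in_realify u l Hu) as [w [Hw [-> | ->]]];
      destruct (proj1 (inner_eq0 HS v w) (O w Hw)) as [E1 E2]; split; auto.
    - rewrite rin_imul_r. lra.
    - rewrite rin_imul. exact E1. }
  split; [exact N | split].
  - intros w [<- | Hw]; [| apply E, Hw]. rewrite rin_sym. apply rin_self_imul.
  - split; [rewrite rin_imul; exact N | split; [intros; apply E; assumption | auto]].
Qed.

Lemma orthogonal_realify f l :
  (forall u, In u (realify l) -> rin HS f u = 0) -> forall v, In v l -> inner HS f v = C0.
Proof.
  intros H v Hv. apply inner_eq0. split.
  - apply H, in_flat_map. exists v. simpl. auto.
  - rewrite <- (Ropp_involutive (rin HS (imul HS f) v)), <- rin_imul_r, H; [ring |].
    apply in_flat_map. exists v. simpl. auto.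
Qed.

(** The last clause expresses without linear combinations that [d] lies in the span of [l] and [p];
    [p] is zero when [l] already spans [d]. *)
Lemma gram_schmidt l d :
  orthonormal l ->
  exists p, (forall v, In v l -> inner HS p v = C0) /\
    forall x, (forall v, In v l -> inner HS x v = C0) -> inner HS x p = C0 -> inner HS x d = C0.
Proof.
  induction l as [| v l IH].
  - intros _. exists d. split; [intros v [] | auto].
  - intros [N [O Ol]]. destruct (IH Ol) as [p [Op Hp]].
    (* The complex coefficient <p,v>, its imaginary part written by [Im_inner]. *)
    set (a := mkC (rin HS p v) (- rin HS (imul HS p) v)).
    exists (vsub HS p (vscal HS a v)). split.
    + intros w [<- | Hw]; apply inner_eq0.
      * rewrite rin_sub_l, rin_imul_sub, rin_vscal_l, imul_vscal, rin_self_imul, N.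
        simpl. split; ring.
      * destruct (proj1 (inner_eq0 HS p w) (Op w Hw)) as [E1 E2].
        destruct (proj1 (inner_eq0 HS v w) (O w Hw)) as [E3 E4].
        rewrite rin_sub_l, rin_imul_sub, rin_vscal_l, imul_vscal, E1, E2, E3, E4. split; ring.
    + intros x Hx Hxp. apply Hp; [intros; apply Hx; simpl; auto |].
      apply inner_eq0 in Hxp. destruct Hxp as [E1 E2].
      destruct (proj1 (inner_eq0 HS x v) (Hx v (or_introl eq_refl))) as [E3 E4].
      rewrite rin_sub_r, rin_vscal_r, rin_imul_r, E3, E4 in E1.
      rewrite rin_sub_r, rin_vscal_r, rin_imul, E3, E4 in E2.
      apply inner_eq0. split; lra.
Qed.

(** The list is the history of the recursion: [P] may refer to all earlier vectors, and its length
    is the current index. *)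
Lemma exists_orthonormal_seq (P : list V -> V -> Prop) :
  (forall l, orthonormal l ->
     exists g, rin HS g g = 1 /\ (forall v, In v l -> inner HS g v = C0) /\ P l g) ->
  exists g : nat -> V, (forall n, rin HS (g n) (g n) = 1) /\
    (forall m n, m <> n -> inner HS (g m) (g n) = C0) /\
    forall n, exists l, length l = n /\ P l (g n) /\
      forall v, In v l -> exists i, v = g i.
Proof.
  intro H.
  (* Choice needs a total relation; non-orthonormal lists get a default value and never occur among
     the [L n]. *)
  assert (H' : forall l, exists g, orthonormal l ->
     rin HS g g = 1 /\ (forall v, In v l -> inner HS g v = C0) /\ P l g).
  { intro l. destruct (classic (orthonormal l)) as [O | O].
    - destruct (H l O) as [g Hg]. exists g. auto.
    - exists (vzero HS). tauto. }
  apply functional_choice in H' as [G HG].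
  set (L := fix L n := match n with O => nil | S k => G (L k) :: L k end).
  assert (OL : forall n, orthonormal (L n)).
  { induction n; simpl; [auto |]. destruct (HG _ IHn) as [? [? _]]. auto. }
  assert (InL : forall n v, In v (L n) -> exists i, v = G (L i)).
  { induction n; simpl; [tauto |]. intros v [<- | Hv]; eauto. }
  assert (LIn : forall n i, (i < n)%nat -> In (G (L i)) (L n)).
  { induction n; intros i Hi; [lia |]. simpl.
    destruct (Nat.eq_dec i n) as [-> | Hn]; [auto | right; apply IHn; lia]. }
  assert (LL : forall n, length (L n) = n) by (induction n; simpl; congruence).
  exists (fun n => G (L n)). split; [| split].
  - intro n. apply (HG _ (OL n)).
  - intros m n Hmn.
    assert (m < n \/ n < m)%nat as [Hl | Hl] by lia.
    + apply inner_eq0_sym, (HG _ (OL n)), LIn, Hl.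
    + apply (HG _ (OL m)), LIn, Hl.
  - intro n. exists (L n). split; [apply LL | split; [apply (HG _ (OL n)) | apply InL]].
Qed.

Lemma orthogonal_dense_zero (d : nat -> V) x :
  (forall y eps, 0 < eps -> exists n, norm HS (vsub HS y (d n)) < eps) ->
  (forall n, inner HS x (d n) = C0) -> x = vzero HS.
Proof.
  intros Hd Hx. apply NNPP. intro Nx. pose proof (norm_gt0 HS x Nx) as P.
  destruct (Hd x (norm HS x) P) as [n Hn].
  pose proof (cauchy_schwarz HS x (vsub HS x (d n))) as CS.
  destruct (proj1 (inner_eq0 HS x (d n)) (Hx n)) as [E _].
  rewrite rin_sub_r, E, Rminus_0_r, <- norm_sq, Rabs_right in CS; nra.
Qed.

(** Indices marked by [F] receive small vectors. Every other index [n] absorbs the dense vector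
    [d (e n)] by Gram-Schmidt, and since [e] reaches every dense vector there, the sequence is
    complete. *)
Lemma adapted_basis (F : nat -> bool) (e : nat -> nat) :
  linear_operator HS dom T -> closed_operator HS dom T ->
  unbounded_operator HS dom T -> dense HS dom ->
  (forall m, exists n, F n = false /\ e n = m) ->
  exists g : nat -> V,
    (forall n, rin HS (g n) (g n) = 1) /\
    (forall m n, m <> n -> inner HS (g m) (g n) = C0) /\
    (forall n, F n = true -> small_on_graph HS dom T ((1/4) ^ n) (g n)) /\
    (forall x, (forall n, inner HS x (g n) = C0) -> x = vzero HS).
Proof.
  intros lin cl unb de He.
  destruct (separable _ HS) as [d Hd].
  destruct (exists_orthonormal_seq (fun l g =>
     (F (length l) = true -> small_on_graph HS dom T ((1/4) ^ length l) g) /\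
     (F (length l) = false -> forall x, (forall v, In v l -> inner HS x v = C0) ->
        inner HS x g = C0 -> inner HS x (d (e (length l))) = C0))) as [g [G1 [G2 G3]]].
  - intros l O.
    assert (Sm : exists f, rin HS f f = 1 /\ (forall v, In v l -> inner HS f v = C0) /\
                   small_on_graph HS dom T ((1/4) ^ length l) f).
    { destruct (exists_small HS dom T lin (realify l) ((1/4) ^ length l) cl unb de) as [f [N [Of S]]].
      - apply real_orthonormal_realify, O.
      - apply pow_lt. lra.
      - exists f. split; [exact N | split; [| exact S]]. apply orthogonal_realify, Of. }
    destruct (F (length l)) eqn:EF.
    + destruct Sm as [f [N [Of S]]]. exists f. repeat split; auto; discriminate.
    + destruct (gram_schmidt l (d (e (length l))) O) as [p [Op Hp]].
      destruct (classic (p = vzero HS)) as [-> | Np].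
      (* Here the dense vector is already spanned, so any unit vector orthogonal to [l] will do. *)
      * destruct Sm as [f [N [Of S]]]. exists f. repeat split; auto; try discriminate.
        intros _ x Hx _. apply Hp; [exact Hx |].
        apply inner_eq0. split; apply rin_zero_r.
      * pose proof (norm_gt0 HS p Np) as P.
        exists (rscal HS (/ norm HS p) p). repeat split; try discriminate.
        -- rewrite rin_rscal_l, rin_rscal_r, <- norm_sq. field. lra.
        -- intros v Hv. apply inner_eq0.
           destruct (proj1 (inner_eq0 HS p v) (Op v Hv)) as [E1 E2].
           rewrite rin_rscal_l, rin_imul_rscal, E1, E2. split; ring.
        -- intros _ x Hx Hxg. apply Hp; [exact Hx |].
           apply inner_eq0 in Hxg. destruct Hxg as [E1 E2].
           rewrite rin_rscal_r in E1, E2.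
           assert (/ norm HS p <> 0) by (apply Rinv_neq_0_compat; lra).
           apply inner_eq0.
           split; (eapply Rmult_eq_reg_l; [rewrite Rmult_0_r |]; eassumption).
  - exists g. repeat split; auto.
    + intros n Fn. destruct (G3 n) as [l [<- [[H _] _]]]. auto.
    + intros x Hx. apply (orthogonal_dense_zero d); [exact Hd |].
      intro m. destruct (He m) as [n [Fn <-]].
      destruct (G3 n) as [l [<- [[_ H] Hl]]]. apply H; auto.
      intros v Hv. destruct (Hl v Hv) as [i ->]. apply Hx.
Qed.

End AdaptedBasis.

(** * Small indices and their targets *)

(* Indices [n] congruent to 2 or 3 modulo 4 carry the small vectors; [target n < n] has the parity
   opposite to [n], and takes each value infinitely often on such indices. *)
Definition is_small (n : nat) : bool := (2 <=? n mod 4)%nat.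
Definition target (n : nat) : nat := (2 * fst (Cantor.of_nat (n / 4)) + (3 - n mod 4))%nat.

Lemma divmod4 q r : (r < 4)%nat -> ((4 * q + r) / 4 = q /\ (4 * q + r) mod 4 = r)%nat.
Proof.
  intro H. split; symmetry; [eapply Nat.div_unique | eapply Nat.mod_unique]; eauto.
Qed.

Lemma is_small_index n :
  is_small n = true -> exists q r, (n = 4 * q + r /\ 2 <= r < 4)%nat.
Proof.
  unfold is_small. intro H. apply Nat.leb_le in H.
  exists (n / 4)%nat, (n mod 4)%nat.
  pose proof (Nat.div_mod_eq n 4).
  assert (n mod 4 < 4)%nat by (apply Nat.mod_upper_bound; discriminate). lia.
Qed.

Lemma target_lt n : is_small n = true -> (target n < n)%nat.
Proof.
  intro H. destruct (is_small_index n H) as [q [r [-> Hr]]]. unfold target.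
  destruct (divmod4 q r) as [-> ->]; [lia |].
  pose proof (Cantor.cancel_to_of q) as E.
  destruct (Cantor.of_nat q) as [a b]. pose proof (Cantor.to_nat_non_decreasing a b). simpl fst. lia.
Qed.

Lemma even_double_add a b : Nat.even (2 * a + b) = Nat.even b.
Proof. rewrite Nat.even_add, Nat.even_mul. simpl. destruct (Nat.even b); reflexivity. Qed.

Lemma target_even n : is_small n = true -> Nat.even (target n) = negb (Nat.even n).
Proof.
  intro H. destruct (is_small_index n H) as [q [r [-> Hr]]]. unfold target.
  destruct (divmod4 q r) as [-> ->]; [lia |].
  replace (4 * q + r)%nat with (2 * (2 * q) + r)%nat by lia.
  rewrite !even_double_add.
  assert (r = 2 \/ r = 3)%nat as [-> | ->] by lia; reflexivity.
Qed.

Lemma target_frequently m N : exists n, (N <= n)%nat /\ is_small n = true /\ target n = m.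
Proof.
  (* Decoding [q] forgets [N], so each m/2 has arbitrarily large codes; the residue 3 - (m mod 2) is
     2 or 3 and stores the parity of [m]. *)
  set (q := Cantor.to_nat ((m / 2)%nat, N)).
  assert (N <= q)%nat by (unfold q; pose proof (Cantor.to_nat_non_decreasing (m / 2)%nat N); lia).
  pose proof (Nat.div_mod_eq m 2).
  assert (m mod 2 < 2)%nat by (apply Nat.mod_upper_bound; discriminate).
  exists (4 * q + (3 - m mod 2))%nat. unfold is_small, target.
  destruct (divmod4 q (3 - m mod 2)) as [-> ->]; [lia |].
  unfold q at 2. rewrite Cantor.cancel_of_to. cbn [fst].
  split; [lia | split; [apply Nat.leb_le; lia | lia]].
Qed.

Lemma pow_antitone q m n : 0 <= q <= 1 -> (m <= n)%nat -> q ^ n <= q ^ m.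
Proof.
  intros Hq H. induction H as [| n H IH]; [lra |].
  assert (0 <= q ^ n) by (apply pow_le; lra). simpl. nra.
Qed.

(** * The symmetric coupling matrix *)

Section Coupling.
Context (b : nat -> bool).

(** Both small indices of a block of four share one bit of [b]. *)
Definition delta (n : nat) : R :=
  if is_small n then (if b (n / 4)%nat then 1 else 1/2) * (1/2) ^ n else 0.

(** The summands are transposes of each other. At most one is nonzero, because [target] decreases
    small indices and [delta] vanishes at the others. *)
Definition coupling (n i : nat) : R :=
  (if (i =? target n)%nat then delta n else 0) + (if (target i =? n)%nat then delta i else 0).

Lemma delta_bounds n : 0 <= delta n <= (1/2) ^ n.
Proof.
  assert (0 < (1/2) ^ n) by (apply pow_lt; lra).
  unfold delta. destruct (is_small n), (b (n / 4)%nat); lra.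
Qed.

Lemma delta_lower n : is_small n = true -> 1/2 * (1/2) ^ n <= delta n.
Proof.
  intro E. assert (0 < (1/2) ^ n) by (apply pow_lt; lra).
  unfold delta. rewrite E. destruct (b (n / 4)%nat); lra.
Qed.

Lemma delta_not_small n : is_small n = false -> delta n = 0.
Proof. unfold delta. intros ->. reflexivity. Qed.

Lemma coupling_sym n i : coupling n i = coupling i n.
Proof.
  unfold coupling. rewrite (Nat.eqb_sym i (target n)), (Nat.eqb_sym n (target i)). ring.
Qed.

Lemma coupling_same_parity n i : Nat.even n = Nat.even i -> coupling n i = 0.
Proof.
  intro E. unfold coupling.
  assert (forall k, delta k = 0 \/ Nat.even (target k) = negb (Nat.even k)) as H.
  { intro k. destruct (is_small k) eqn:Ek; [right; apply target_even, Ek | left; apply delta_not_small, Ek]. }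
  destruct (Nat.eqb_spec i (target n)) as [E1 | _], (Nat.eqb_spec (target i) n) as [E2 | _];
    destruct (H n) as [Dn | Hn]; destruct (H i) as [Di | Hi]; try lra; exfalso;
    try (rewrite <- E1, E in Hn; destruct (Nat.even i); discriminate);
    rewrite E2, E in Hi; destruct (Nat.even i); discriminate.
Qed.

(** Apart from its target, a row meets only later small indices, where vectors of the domain have
    tiny coefficients. *)
Lemma coupling_off_target n i :
  i <> target n -> coupling n i <> 0 -> (n < i)%nat /\ is_small i = true /\ coupling n i = delta i.
Proof.
  unfold coupling. intros Hi.
  destruct (Nat.eqb_spec i (target n)) as [E | _]; [contradiction |].
  destruct (Nat.eqb_spec (target i) n) as [E | _]; [| lra].
  intro H. destruct (is_small i) eqn:Ei.
  - pose proof (target_lt i Ei). split; [lia | split; [reflexivity | ring]].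
  - rewrite (delta_not_small i Ei) in H. lra.
Qed.

Lemma coupling_target n : is_small n = true -> coupling n (target n) = delta n.
Proof.
  intro E. unfold coupling. rewrite Nat.eqb_refl.
  destruct (Nat.eqb_spec (target (target n)) n) as [E2 | _]; [| ring].
  destruct (is_small (target n)) eqn:E3.
  - pose proof (target_lt n E). pose proof (target_lt _ E3). lia.
  - rewrite (delta_not_small _ E3). ring.
Qed.

(** The decay is in the column index, as [series_sum] requires; at i = target n it follows from
    target n < n. *)
Lemma coupling_bound n i : Rabs (coupling n i) <= (1/2) ^ i.
Proof.
  assert (0 < (1/2) ^ i) by (apply pow_lt; lra).
  destruct (Req_dec (coupling n i) 0) as [-> | H0]; [rewrite Rabs_R0; lra |].
  destruct (Nat.eq_dec i (target n)) as [Ei | Ni].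
  - destruct (is_small n) eqn:En.
    + subst i. rewrite coupling_target by exact En.
      pose proof (delta_bounds n). pose proof (target_lt n En).
      assert ((1/2) ^ n <= (1/2) ^ target n) by (apply pow_antitone; [lra | lia]).
      rewrite Rabs_right; lra.
    + revert H0. unfold coupling. rewrite (delta_not_small n En).
      destruct (i =? target n)%nat, (target i =? n)%nat; pose proof (delta_bounds i);
        intros; rewrite Rabs_right; lra.
  - destruct (coupling_off_target n i Ni H0) as [_ [_ ->]].
    pose proof (delta_bounds i). rewrite Rabs_right; lra.
Qed.

End Coupling.

(** * The tilted basis and the subspaces it defines *)

Section TiltedBasis.
Context {V : Type} (HS : HilbertSpace V) (g : nat -> V).
Context (g_unit : forall n, rin HS (g n) (g n) = 1).
Context (g_orth : forall m n, m <> n -> inner HS (g m) (g n) = C0).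

(** [Z b n] stands for the sum over i of [coupling b n i] times [g i], known only through the
    estimate of [series_sum]. *)
Definition is_coupled_sum (Z : (nat -> bool) -> nat -> V) : Prop :=
  forall b n y A j,
    (forall i, i <> j -> Rabs (coupling b n i * rin HS (g i) y) <= A * (1/2) ^ i) ->
    Rabs (rin HS (Z b n) y - coupling b n j * rin HS (g j) y) <= 2 * A.

Lemma exists_coupled_sum : exists Z, is_coupled_sum Z.
Proof.
  destruct (functional_choice (fun (p : (nat -> bool) * nat) t => forall y A j,
    (forall i, i <> j -> Rabs (coupling (fst p) (snd p) i * rin HS (g i) y) <= A * (1/2) ^ i) ->
    Rabs (rin HS t y - coupling (fst p) (snd p) j * rin HS (g j) y) <= 2 * A)) as [Z HZ].
  - intros [b n]. apply series_sum; [exact g_unit | apply coupling_bound].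
  - exists (fun b n => Z (b, n)). intros b n. apply (HZ (b, n)).
Qed.

Context (Z : (nat -> bool) -> nat -> V) (HZ : is_coupled_sum Z).

Definition tilted (b : nat -> bool) (n : nat) : V :=
  vadd HS (g n) (rscal HS (if Nat.even n then 1 else -1) (Z b n)).

Definition tilted_complement (b : nat -> bool) (x : V) : Prop :=
  forall n, Nat.even n = false -> inner HS x (tilted b n) = C0.

Lemma coupled_eq b n y j :
  (forall i, i <> j -> coupling b n i * rin HS (g i) y = 0) ->
  rin HS (Z b n) y = coupling b n j * rin HS (g j) y.
Proof.
  intro H.
  assert (B : Rabs (rin HS (Z b n) y - coupling b n j * rin HS (g j) y) <= 2 * 0).
  { apply HZ. intros i Hi. rewrite (H i Hi), Rabs_R0. lra. }
  pose proof (Rle_abs (rin HS (Z b n) y - coupling b n j * rin HS (g j) y)) as B1.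
  pose proof (Rle_abs (- (rin HS (Z b n) y - coupling b n j * rin HS (g j) y))) as B2.
  rewrite Rabs_Ropp in B2. lra.
Qed.

Lemma g_rin m n : m <> n -> rin HS (g m) (g n) = 0.
Proof. intro H. apply (proj1 (inner_eq0 HS _ _) (g_orth m n H)). Qed.

Lemma g_imul m n : rin HS (imul HS (g m)) (g n) = 0.
Proof.
  destruct (Nat.eq_dec m n) as [-> | H]; [apply rin_self_imul |].
  apply (proj1 (inner_eq0 HS _ _) (g_orth m n H)).
Qed.

Lemma coupled_g b n j : rin HS (Z b n) (g j) = coupling b n j.
Proof.
  rewrite (coupled_eq b n (g j) j); [rewrite g_unit; ring |].
  intros i Hi. rewrite g_rin by exact Hi. ring.
Qed.

Lemma coupled_imul_g b n j : rin HS (imul HS (Z b n)) (g j) = 0.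
Proof.
  rewrite <- (Ropp_involutive (rin HS (imul HS (Z b n)) (g j))), <- rin_imul_r.
  (* All terms vanish, so the index 0 singled out is arbitrary. *)
  rewrite (coupled_eq b n (imul HS (g j)) 0); intros; rewrite rin_imul_r, g_imul; ring.
Qed.

(** Each row is supported on the parity opposite to its index, so the two supports are disjoint. *)
Lemma coupled_coupled b b' m n :
  Nat.even m = negb (Nat.even n) -> rin HS (Z b m) (Z b' n) = 0.
Proof.
  intro E.
  assert (H : forall i, coupling b m i * rin HS (g i) (Z b' n) = 0).
  { intro i. rewrite rin_sym, coupled_g.
    destruct (Bool.bool_dec (Nat.even m) (Nat.even i)) as [Ei | Ei].
    - rewrite (coupling_same_parity b m i Ei). ring.
    - rewrite (coupling_same_parity b' n i); [ring |].
      destruct (Nat.even m), (Nat.even n), (Nat.even i); simpl in *; congruence. }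
  rewrite (coupled_eq b m (Z b' n) 0); auto.
Qed.

Lemma coupled_imul_coupled b b' m n : rin HS (imul HS (Z b m)) (Z b' n) = 0.
Proof.
  rewrite rin_sym, (coupled_eq b' n (imul HS (Z b m)) 0);
    intros; rewrite (rin_sym HS (g _)), coupled_imul_g; ring.
Qed.

(** The opposite signs of the tilts turn the two cross terms into a difference, which symmetry of
    the coupling cancels for b = b'. Allowing b and b' to differ is what distinguishes the
    subspaces. *)
Lemma rin_tilted b b' m n :
  Nat.even m = true -> Nat.even n = false ->
  rin HS (tilted b m) (tilted b' n) = coupling b m n - coupling b' m n.
Proof.
  intros Em En. unfold tilted. rewrite Em, En.
  rewrite rin_add_l, !rin_add_r, !rin_rscal_l, !rin_rscal_r.
  rewrite (rin_sym HS (g m) (Z b' n)), !coupled_g, coupled_coupled by (rewrite Em, En; reflexivity).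
  rewrite g_rin by congruence. rewrite (coupling_sym b' n m). ring.
Qed.

Lemma imul_tilted b b' m n : rin HS (imul HS (tilted b m)) (tilted b' n) = 0.
Proof.
  unfold tilted.
  rewrite rin_imul_add, !rin_add_r, !rin_imul_rscal, !rin_rscal_r.
  rewrite g_imul, coupled_imul_g, coupled_imul_coupled.
  pose proof (rin_imul_r HS (Z b' n) (g m)) as E.
  rewrite coupled_imul_g, rin_sym in E. rewrite E. ring.
Qed.

Lemma tilted_in_complement b m : Nat.even m = true -> tilted_complement b (tilted b m).
Proof.
  intros Em n En. apply inner_eq0. split; [| apply imul_tilted].
  rewrite rin_tilted by assumption. ring.
Qed.

Lemma tilted_complement_inj b b' :
  (forall x, tilted_complement b x -> tilted_complement b' x) -> forall j, b j = b' j.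
Proof.
  (* This [n] is the even small index of block [j]. As [tilted b n] lies in both complements,
     pairing it with [tilted b' (target n)] equates the two values of [delta n], hence the bits. *)
  intros H j. set (n := (4 * j + 2)%nat).
  assert (Sn : is_small n = true).
  { unfold is_small, n. destruct (divmod4 j 2) as [_ ->]; [lia | reflexivity]. }
  assert (En : Nat.even n = true).
  { unfold n. replace (4 * j + 2)%nat with (2 * (2 * j + 1) + 0)%nat by lia. apply even_double_add. }
  assert (Et : Nat.even (target n) = false) by (rewrite target_even, En by exact Sn; reflexivity).
  pose proof (H _ (tilted_in_complement b n En) (target n) Et) as E.
  apply inner_eq0 in E. destruct E as [E _].
  rewrite rin_tilted, !coupling_target in E by assumption.
  unfold delta in E. rewrite Sn in E.
  replace (n / 4)%nat with j in E by (unfold n; destruct (divmod4 j 2) as [-> _]; [lia | reflexivity]).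
  assert (0 < (1/2) ^ n) by (apply pow_lt; lra).
  destruct (b j), (b' j); try reflexivity; lra.
Qed.

Lemma subspace_tilted_complement b : subspace HS (tilted_complement b).
Proof.
  split; [split; [| split] |].
  - intros n _. apply inner_eq0. split; [apply rin_zero_l |].
    rewrite <- (Ropp_involutive (rin HS (imul HS _) _)), <- rin_imul_r, rin_zero_l. ring.
  - intros x y Hx Hy n En. rewrite inner_add_l, Hx, Hy by exact En. apply C_ext; simpl; ring.
  - intros a x Hx n En. rewrite inner_scal_l, Hx by exact En. apply C_ext; simpl; ring.
  - intros u l Hu Hl n En.
    assert (Lim : forall y, (forall k, rin HS (u k) y = 0) -> rin HS l y = 0).
    { intros y Hy.
      assert (B : Rabs (rin HS l y) <= 0).
      { apply le_of_forall_eps. intros eps He. pose proof (norm_pos HS y) as P.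
        destruct (Hl (eps / (norm HS y + 1))) as [N HN]; [apply Rdiv_lt_0_compat; lra |].
        specialize (HN N (le_n N)).
        pose proof (cauchy_schwarz HS (vsub HS (u N) l) y) as CS.
        rewrite rin_sub_l, Hy, Rminus_0_l, Rabs_Ropp in CS.
        assert (eps = eps / (norm HS y + 1) * (norm HS y + 1)) as E by (field; lra).
        set (k := eps / (norm HS y + 1)) in *.
        pose proof (norm_pos HS (vsub HS (u N) l)). nra. }
      destruct (Req_dec (rin HS l y) 0) as [E | E]; [exact E |].
      pose proof (Rabs_pos_lt _ E). lra. }
    apply inner_eq0. split.
    + apply Lim. intro k. apply (proj1 (inner_eq0 HS _ _) (Hu k n En)).
    + rewrite <- (Ropp_involutive (rin HS (imul HS l) _)), <- rin_imul_r.
      rewrite Lim; [ring |]. intro k. rewrite rin_imul_r.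
      rewrite (proj2 (proj1 (inner_eq0 HS _ _) (Hu k n En))). ring.
Qed.

(* If [n] is small then [x] has a tiny coefficient on [g n] and on the later terms of [Z b n], so
   [x] orthogonal to [tilted b n] forces a tiny coefficient on the remaining term [g (target n)],
   even after division by [delta n]. Letting [n] grow with a fixed target kills that coefficient. *)
Lemma tilted_unique (b : nat -> bool) (par : bool) (x : V) (C : R) :
  0 <= C ->
  (forall i, is_small i = true -> Rabs (rin HS x (g i)) <= C * (1/4) ^ i) ->
  (forall n, Nat.even n = par -> rin HS x (tilted b n) = 0) ->
  forall i, rin HS x (g i) = 0.
Proof.
  intros HC Hs Ht.
  assert (Hn : forall n, Nat.even n = par -> Rabs (rin HS (Z b n) x) = Rabs (rin HS x (g n))).
  { intros n En. specialize (Ht n En). unfold tilted in Ht.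
    rewrite rin_add_r, rin_rscal_r, (rin_sym HS x (Z b n)) in Ht.
    destruct (Nat.even n).
    - replace (rin HS (Z b n) x) with (- rin HS x (g n)) by lra. apply Rabs_Ropp.
    - f_equal. lra. }
  (* First the parity opposite to [par]: such an [m] is the target of arbitrarily large small [n],
     all of parity [par]. *)
  assert (Opp : forall m, Nat.even m = negb par -> rin HS x (g m) = 0).
  { intros m Em.
    assert (B : Rabs (rin HS x (g m)) <= 0).
    { apply le_of_forall_eps. intros eps He.
      destruct (geometric_small (6 * C) (1/2) eps) as [N HN]; [lra | lra | exact He |].
      destruct (target_frequently m N) as [n [Ln [Sn Tn]]].
      specialize (HN n Ln).
      assert (En : Nat.even n = par).
      { pose proof (target_even n Sn) as E. rewrite Tn, Em in E.
        destruct (Nat.even n), par; simpl in E; congruence. }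
      (* Terms off the target have i > n and i small, hence are at most C 4^-i 2^-i <= (C 4^-n)
         2^-i. *)
      assert (B : Rabs (rin HS (Z b n) x - coupling b n m * rin HS (g m) x) <= 2 * (C * (1/4) ^ n)).
      { apply HZ. intros i Hi. rewrite <- Tn in Hi.
        assert (0 < (1/2) ^ i) by (apply pow_lt; lra).
        assert (0 < (1/4) ^ n) by (apply pow_lt; lra).
        destruct (Req_dec (coupling b n i) 0) as [-> | N0].
        - rewrite Rmult_0_l, Rabs_R0. apply Rmult_le_pos; nra.
        - destruct (coupling_off_target b n i Hi N0) as [Li [Si _]].
          rewrite Rabs_mult, (Rmult_comm (Rabs (coupling b n i))).
          apply Rmult_le_compat; try apply Rabs_pos; [| apply coupling_bound].
          rewrite rin_sym. eapply Rle_trans; [apply Hs, Si |].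
          apply Rmult_le_compat_l; [exact HC |].
          apply pow_antitone; [lra | lia]. }
      rewrite <- Tn in B at 1. rewrite coupling_target in B by exact Sn.
      pose proof (Hs n Sn) as Bn. rewrite <- (Hn n En) in Bn.
      pose proof (delta_lower b n Sn) as Dn.
      assert (P2 : 0 < (1/2) ^ n) by (apply pow_lt; lra).
      assert (P4 : (1/4) ^ n = (1/2) ^ n * (1/2) ^ n)
        by (rewrite <- Rpow_mult_distr; f_equal; lra).
      (* The tail contributes 2 C 4^-n and <Z b n, x> another C 4^-n; dividing by delta n >= 2^-n /
         2 leaves 6 C 2^-n. *)
      assert (B' : delta b n * Rabs (rin HS x (g m)) <= 3 * (C * (1/4) ^ n)).
      { rewrite <- (Rabs_right (delta b n)) by lra.
        rewrite <- Rabs_mult, (rin_sym HS x (g m)).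
        pose proof (Rabs_triang_inv (delta b n * rin HS (g m) x) (rin HS (Z b n) x)) as Tr.
        rewrite Rabs_minus_sym in Tr. lra. }
      pose proof (Rabs_pos (rin HS x (g m))) as Pm.
      rewrite P4 in B'.
      assert ((1/2) ^ n * Rabs (rin HS x (g m)) <= (1/2) ^ n * (6 * C * (1/2) ^ n)) by nra.
      apply Rmult_le_reg_l in H; lra. }
    destruct (Req_dec (rin HS x (g m)) 0) as [E | E]; [exact E |].
    pose proof (Rabs_pos_lt _ E). lra. }
  intro i. destruct (Bool.bool_dec (Nat.even i) par) as [Ei | Ei].
  (* For parity [par], the row involves only the coefficients just shown to vanish. *)
  - assert (Zi : rin HS (Z b i) x = 0).
    { assert (Terms : forall j, coupling b i j * rin HS (g j) x = 0).
      { intro j. destruct (Bool.bool_dec (Nat.even i) (Nat.even j)) as [E | E].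
        - rewrite coupling_same_parity by exact E. ring.
        - rewrite rin_sym, Opp; [ring |].
          destruct (Nat.even i), (Nat.even j), par; simpl; congruence. }
      rewrite (coupled_eq b i x 0); auto. }
    specialize (Hn i Ei). rewrite Zi, Rabs_R0 in Hn.
    destruct (Req_dec (rin HS x (g i)) 0) as [E | E]; [exact E |].
    pose proof (Rabs_pos_lt _ E). lra.
  - apply Opp. destruct (Nat.even i), par; simpl; congruence.
Qed.

End TiltedBasis.

(** Cantor's diagonal: [b0] differs at bit [n] from every sequence whose set is listed as [f n]; by
    injectivity there is at most one, up to pointwise equality. *)
Lemma uncountable_of_injective_family {V : Type} (P : (V -> Prop) -> Prop)
  (M : (nat -> bool) -> V -> Prop) :
  (forall b, P (M b)) ->
  (forall b b', (forall x, M b x -> M b' x) -> forall n, b n = b' n) ->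
  uncountably_many_sets P.
Proof.
  intros HP inj [f Hf].
  assert (D : forall n, exists c, forall b, (forall x, f n x <-> M b x) -> b n <> c).
  { intro n. destruct (classic (exists b, forall x, f n x <-> M b x)) as [[b Hb] | Nb].
    - exists (negb (b n)). intros b' Hb'.
      rewrite (inj b' b); [destruct (b n); discriminate |].
      intros x Hx. apply Hb, Hb', Hx.
    - exists true. intros b Hb. exfalso. eauto. }
  apply functional_choice in D as [b0 Hb0].
  destruct (Hf (M b0) (HP b0)) as [n Hn]. exact (Hb0 n b0 Hn eq_refl).
Qed.

(** * The fundamental symmetry of a subspace *)

Section Reflection.
Context {V : Type} (HS : HilbertSpace V).

Lemma projection_unique (M : V -> Prop) x p p' :
  subspace HS M -> M p -> M p' ->
  ortho HS M (vsub HS x p) -> ortho HS M (vsub HS x p') -> p = p'.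
Proof.
  intros [LM _] Mp Mp' Op Op'. pose proof (manifold_sub HS M p p' LM Mp Mp') as Md.
  assert (Z : vsub HS p p' = vzero HS).
  { apply rin_eq0.
    destruct (proj1 (inner_eq0 HS _ _) (Op _ Md)) as [E1 _].
    destruct (proj1 (inner_eq0 HS _ _) (Op' _ Md)) as [E2 _].
    rewrite rin_sub_l in E1, E2 |- *. lra. }
  apply vec_ext with HS. intro z.
  pose proof (rin_sub_l HS p p' z) as E. rewrite Z, rin_zero_l in E. lra.
Qed.

(** J = 2P - I with P a chosen projection onto [M]. Uniqueness of projections makes P linear and
    gives P J = P, hence J J = I; moreover x + J x = 2 P x and x - J x = 2 (x - P x). *)
Lemma exists_reflection (M : V -> Prop) :
  subspace HS M ->
  exists J, fundamental_symmetry HS J /\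
    (forall x, M (vadd HS x (J x))) /\ (forall x, ortho HS M (vsub HS x (J x))) /\
    (forall x, J x = x <-> M x).
Proof.
  intro SM. pose proof SM as [LM _]. pose proof LM as [M0 [Ma Ms]].
  destruct (functional_choice (fun x p => M p /\ ortho HS M (vsub HS x p))) as [P HP].
  { intro x. apply projection, SM. }
  assert (U : forall x p, M p -> ortho HS M (vsub HS x p) -> P x = p).
  { intros x p Mp Op. apply (projection_unique M x); try apply HP; assumption. }
  set (J := fun x => vsub HS (rscal HS 2 (P x)) x).
  assert (EP : forall x y, rin HS (P x) (P y) = rin HS x (P y)).
  { intros x y. destruct (HP x) as [_ O].
    destruct (proj1 (inner_eq0 HS _ _) (O _ (proj1 (HP y)))) as [E _].
    rewrite rin_sub_l in E. lra. }
  assert (SA : forall x y, rin HS (J x) y = rin HS x (J y)).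
  { intros x y. unfold J. rewrite rin_sub_l, rin_sub_r, rin_rscal_l, rin_rscal_r.
    pose proof (EP x y) as E1. pose proof (EP y x) as E2.
    rewrite (rin_sym HS y (P x)), (rin_sym HS (P y) (P x)) in E2. lra. }
  assert (Padd : forall x y, P (vadd HS x y) = vadd HS (P x) (P y)).
  { intros x y. apply U; [apply Ma; apply HP |].
    intros m Mm. destruct (HP x) as [_ Ox], (HP y) as [_ Oy].
    replace (vsub HS (vadd HS x y) (vadd HS (P x) (P y)))
      with (vadd HS (vsub HS x (P x)) (vsub HS y (P y))).
    - rewrite inner_add_l, Ox, Oy by exact Mm. apply C_ext; simpl; ring.
    - apply vec_ext with HS. intro. rewrite rin_sub_l, !rin_add_l, !rin_sub_l. ring. }
  assert (Pscal : forall a x, P (vscal HS a x) = vscal HS a (P x)).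
  { intros a x. apply U; [apply Ms; apply HP |].
    intros m Mm. destruct (HP x) as [_ Ox].
    replace (vsub HS (vscal HS a x) (vscal HS a (P x))) with (vscal HS a (vsub HS x (P x))).
    - rewrite inner_scal_l, Ox by exact Mm. apply C_ext; simpl; ring.
    - apply vec_ext with HS. intro. rewrite rin_sub_l, !rin_vscal_l, rin_imul_sub, rin_sub_l. ring. }
  assert (Jscal : forall a x, J (vscal HS a x) = vscal HS a (J x)).
  { intros a x. unfold J. rewrite Pscal. apply vec_ext with HS. intro.
    rewrite !rin_sub_l, rin_rscal_l, !rin_vscal_l, rin_imul_sub, !rin_sub_l,
      rin_imul_rscal, rin_rscal_l. ring. }
  assert (PM : forall x, M x -> P x = x).
  { intros x Mx. apply U; [exact Mx |]. intros m _. apply inner_eq0.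
    rewrite rin_imul_sub, rin_sub_l. split; ring. }
  assert (PJ : forall x, P (J x) = P x).
  { intro x. apply U; [apply HP |]. intros m Mm. destruct (HP x) as [_ Ox].
    destruct (proj1 (inner_eq0 HS _ _) (Ox m Mm)) as [E1 E2].
    rewrite rin_sub_l in E1. rewrite rin_imul_sub in E2.
    unfold J. apply inner_eq0.
    rewrite !rin_sub_l, !rin_imul_sub, rin_rscal_l, rin_imul_rscal. split; lra. }
  assert (JJ : forall x, J (J x) = x).
  { intro x. unfold J at 1. rewrite PJ. apply vec_ext with HS. intro. unfold J.
    rewrite !rin_sub_l. ring. }
  exists J. split; [split; [split; [| split] | split] | split; [| split]].
  - intros x y. unfold J. rewrite Padd. apply vec_ext with HS. intro.
    rewrite !rin_sub_l, !rin_rscal_l, !rin_add_l, !rin_sub_l, !rin_rscal_l. ring.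
  - exact Jscal.
  - exists 1. intro x. rewrite Rmult_1_l. unfold norm.
    fold (rin HS (J x) (J x)) (rin HS x x). rewrite SA, JJ. lra.
  - intros x y. apply C_ext; [exact (SA x y) |].
    rewrite !Im_inner, <- SA. unfold imul. rewrite Jscal. reflexivity.
  - exact JJ.
  - intro x. replace (vadd HS x (J x)) with (rscal HS 2 (P x)); [apply Ms, HP |].
    apply vec_ext with HS. intro. unfold J. rewrite rin_add_l, rin_sub_l. ring.
  - intros x m Mm. destruct (HP x) as [_ Ox].
    destruct (proj1 (inner_eq0 HS _ _) (Ox m Mm)) as [E1 E2].
    rewrite rin_sub_l in E1. rewrite rin_imul_sub in E2.
    unfold J. apply inner_eq0.
    rewrite !rin_sub_l, !rin_imul_sub, rin_rscal_l, rin_imul_rscal. split; lra.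
  - intro x. split.
    + intro E. replace x with (P x); [apply HP |].
      apply vec_ext with HS. intro z.
      assert (E' : rin HS (J x) z = rin HS x z) by (rewrite E; reflexivity).
      unfold J in E'. rewrite rin_sub_l, rin_rscal_l in E'. lra.
    + intro Mx. unfold J. rewrite PM by exact Mx.
      apply vec_ext with HS. intro. rewrite rin_sub_l, rin_rscal_l. ring.
Qed.

End Reflection.

Theorem theorem3p17 (V : Type) (HS : HilbertSpace V)
  (dom : V -> Prop) (T : V -> V) :
  linear_operator HS dom T ->
  closed_operator HS dom T ->
  unbounded_operator HS dom T ->
  densely_defined HS dom ->
  uncountably_many_sets
    (fun M => subspace HS M /\
       (forall x, M x -> dom x -> x = vzero HS) /\
       (forall x, ortho HS M x -> dom x -> x = vzero HS))
  /\
  uncountably_many_ops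
    (fun J => fundamental_symmetry HS J /\
       (forall x, dom x -> dom (J x) -> J x = vzero HS)).
Proof.
  intros lin cl unb de.
  assert (Sets : uncountably_many_sets
    (fun M => subspace HS M /\
       (forall x, M x -> dom x -> x = vzero HS) /\
       (forall x, ortho HS M x -> dom x -> x = vzero HS))).
  (* The non-small index 4 m lies in block m, so n / 4 takes every value at non-small indices. *)
  { destruct (adapted_basis HS dom T is_small (fun n => n / 4)%nat lin cl unb de)
      as [g [Gu [Go [Gs Gz]]]].
    { intro m. exists (4 * m + 0)%nat. unfold is_small.
      destruct (divmod4 m 0) as [-> ->]; [lia | split; reflexivity]. }
    destruct (exists_coupled_sum HS g Gu) as [Z HZ].
    assert (Zero : forall b par x, dom x ->
      (forall n, Nat.even n = par -> inner HS x (tilted HS g Z b n) = C0) -> x = vzero HS).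
    { assert (Real : forall b par x, dom x ->
        (forall n, Nat.even n = par -> rin HS x (tilted HS g Z b n) = 0) ->
        forall i, rin HS x (g i) = 0).
      { intros b par x Dx Hx.
        destruct (small_on_graph_bound HS dom T lin x Dx) as [C [HC HCs]].
        apply (tilted_unique HS g Z HZ b par x C); auto. }
      intros b par x Dx Hx. apply Gz. intro n. apply inner_eq0. split.
      - apply (Real b par); [exact Dx |].
        intros k Ek. apply (proj1 (inner_eq0 HS _ _) (Hx k Ek)).
      (* The imaginary parts are the real parts for i x, which is again in the domain. *)
      - apply (Real b par); [apply (dom_vscal HS dom T lin), Dx |].
        intros k Ek. apply (proj1 (inner_eq0 HS _ _) (Hx k Ek)). }
    apply uncountable_of_injective_family with (M := tilted_complement HS g Z).
    - intro b. split; [apply subspace_tilted_complement | split].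
      + intros x Mx Dx. apply (Zero b false x Dx Mx).
      + intros x Ox Dx. apply (Zero b true x Dx).
        intros n En. apply Ox, tilted_in_complement; assumption.
    - apply tilted_complement_inj; assumption. }
  split; [exact Sets |].
  (* An enumeration of the symmetries would enumerate their fixed spaces, among which every
     admissible [M] occurs. *)
  intros [f Hf]. apply Sets. exists (fun n x => f n x = x).
  intros M [SM [D1 D2]].
  destruct (exists_reflection HS M SM) as [J [FJ [J1 [J2 J3]]]].
  destruct (Hf J) as [n Hn].
  - split; [exact FJ |]. intros x Dx DJ.
    assert (E1 := D1 _ (J1 x) (dom_add HS dom T lin _ _ Dx DJ)).
    assert (E2 := D2 _ (J2 x) (manifold_sub HS dom x (J x) (proj1 lin) Dx DJ)).
    apply vec_ext with HS. intro z.
    assert (A1 : rin HS (vadd HS x (J x)) z = 0) by (rewrite E1; apply rin_zero_l).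
    assert (A2 : rin HS (vsub HS x (J x)) z = 0) by (rewrite E2; apply rin_zero_l).
    rewrite rin_add_l in A1. rewrite rin_sub_l in A2. rewrite rin_zero_l. lra.
  - exists n. intro x. rewrite Hn. apply J3.
Qed.
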